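(* Let $\pi:R\to S$ be an epimorphism between unital rings. Let $\mathrm{rk}_S$ be an extended Sylvester map rank function for $S$, and let $\mathrm{rk}_R:=\pi^*(\mathrm{rk}_S)$ be the extended Sylvester map rank function for $R$ defined by $\mathrm{rk}_R(\alpha)=\mathrm{rk}_S(\mathrm{id}_S\otimes_R\alpha)$ for every map $\alpha$ between $R$-modules. Then for any map $\alpha:\mathcal{N}_1\to\mathcal{N}_2$ between $S$-modules, $$\mathrm{rk}_S(\alpha)=\mathrm{rk}_R(\alpha),$$ where on the right-hand side $\alpha$ is regarded as a map of $R$-modules via $\pi$. In particular, the map $\pi^*:\mathbb{P}(S)\to\mathbb{P}(R)$ is injective.
   Context: All modules are left modules; maps between modules are module homomorphisms, written on the right of their arguments, so $\alpha\beta$ means first $\alpha$, then $\beta$. A unital ring homomorphism $\pi:R\to S$ is an epimorphism if any two unital ring homomorphisms from $S$ to a unital ring $Q$ that agree after precomposing with $\pi$ are equal. An extended Sylvester map rank function for a unital ring $R$ is an $\mathbb{R}_{\ge 0}\cup\{+\infty\}$-valued function $\mathrm{rk}$ on the class of all maps between $R$-modules such that: (1) $\mathrm{rk}(0)=0$, $\mathrm{rk}(\mathrm{id}_R)=1$; (2) $\mathrm{rk}(\alpha\beta)\le\min(\mathrm{rk}(\alpha),\mathrm{rk}(\beta))$ for composable maps; (3) $\mathrm{rk}(\alpha\oplus\beta)=\mathrm{rk}(\alpha)+\mathrm{rk}(\beta)$; (4) if $(\mathcal{M}_j,\beta_{jk})$ is a direct system of $R$-modules over a directed set $J$ with direct limit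 $\mathcal{M}_\infty$ and canonical maps $\beta_j:\mathcal{M}_j\to\mathcal{M}_\infty$, and $\alpha_j:\mathcal{M}_j\to\mathcal{M}$, $\alpha_\infty:\mathcal{M}_\infty\to\mathcal{M}$ are maps to an $R$-module $\mathcal{M}$ with $\beta_{jk}\alpha_k=\alpha_j$ for $j\le k$ and $\beta_j\alpha_\infty=\alpha_j$ for all $j$, then $\mathrm{rk}(\alpha_\infty)=\lim_{j\to\infty}\mathrm{rk}(\alpha_j)$; (5) if $(\mathcal{M}_j,\beta_{jk})$, $\mathcal{M}_\infty$, $\beta_j$ are as in (4), and $\alpha_j:\mathcal{M}\to\mathcal{M}_j$, $\alpha_\infty:\mathcal{M}\to\mathcal{M}_\infty$ are maps from a finitely generated $R$-module $\mathcal{M}$ with $\alpha_j\beta_{jk}=\alpha_k$ for $j\le k$ and $\alpha_j\beta_j=\alpha_\infty$ for all $j$, then $\mathrm{rk}(\alpha_\infty)=\lim_{j\to\infty}\mathrm{rk}(\alpha_j)$; (6) for any map $\alpha:\mathcal{M}_1\to\mathcal{M}_2$, $\mathrm{rk}(\mathrm{id}_{\mathcal{M}_2})=\mathrm{rk}(\alpha)+\mathrm{rk}(\mathrm{id}_{\mathrm{coker}(\alpha)})$. $\mathbb{P}(R)$ denotes the set of all Sylvester rank functions for $R$; here its elements are taken to be the extended Sylvester map rank functions for $R$ (which are in natural bijection with Sylvester matrix rank functions on rectangular matrices over $R$, by restricting to maps between finitely generated free modules). For any unital ring homomorphism $\pi:R\to S$, the formula $\pi^*(\mathrm{rk}_S)(\alpha):=\mathrm{rk}_S(\mathrm{id}_S\otimes_R\alpha)$,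 for all maps $\alpha$ between $R$-modules, defines a map $\pi^*:\mathbb{P}(S)\to\mathbb{P}(R)$; on matrices $A$ over $R$ it reads $\pi^*(\mathrm{rk}_S)(A)=\mathrm{rk}_S(\pi(A))$. *)

(* Defs.v *)
From HB Require Import structures.
From mathcomp Require Import all_boot all_order all_algebra.
From mathcomp Require Import all_classical all_reals all_analysis.

Set Implicit Arguments.
Unset Strict Implicit.
Unset Printing Implicit Defensive.

Import Order.TTheory GRing.Theory Num.Theory.

Local Open Scope classical_set_scope.
Local Open Scope quotient_scope.
Local Open Scope ring_scope.

(* [pzRingType] is the type of all unital rings, the zero ring included, and
   [lmodType R] that of left R-modules.  Maps are written on the left, so the
   composite "first f, then g" is [g \o f]. *)

Definition ring_epi (R S : pzRingType) (pi : {rmorphism R -> S}) : Prop :=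
  forall (Q : pzRingType) (f g : {rmorphism S -> Q}),
    f \o pi =1 g \o pi -> f =1 g.

Definition mk_linear (R : pzRingType) (M N : lmodType R) (f : M -> N)
    (fL : linear f) : {linear M -> N} :=
  HB.pack f (GRing.isLinear.Build R M N *:%R f fL).

Lemma linear_ext (R : pzRingType) (M N : lmodType R) (f g : {linear M -> N}) :
  f =1 g -> f = g.
Proof.
move=> /funext; case: f => f [[fA] [fZ]]; case: g => g [[gA] [gZ]] /= fg.
subst g; by rewrite (Prop_irrelevance fA gA) (Prop_irrelevance fZ gZ).
Qed.

Section Coker.
Context (R : pzRingType) (M N : lmodType R) (f : {linear M -> N}).

Definition coker_rel (x y : N) : bool := `[< exists m, x - y = f m >].

Lemma coker_rel_refl : reflexive coker_rel.
Proof. by move=> x; apply/asboolP; exists 0; rewrite subrr linear0. Qed.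

Lemma coker_rel_sym : symmetric coker_rel.
Proof.
by move=> x y; apply/asboolP/asboolP => -[m e]; exists (- m);
  rewrite linearN -e opprB.
Qed.

Lemma coker_rel_trans : transitive coker_rel.
Proof.
move=> y x z /asboolP[m e] /asboolP[m' e']; apply/asboolP; exists (m + m').
by rewrite linearD -e -e' addrA subrK.
Qed.

Canonical coker_equiv :=
  EquivRel coker_rel coker_rel_refl coker_rel_sym coker_rel_trans.

Definition coker : Type := {eq_quot coker_equiv}.
HB.instance Definition _ := Choice.on coker.
HB.instance Definition _ := EqQuotient.on coker.

Lemma coker_ind (P : coker -> Prop) :
  (forall x, P (\pi_coker x)) -> forall x, P x.
Proof. by move=> h x; rewrite -[x]reprK. Qed.

Lemma coker_eq (x y : N) :
  (\pi_coker x = \pi_coker y) <-> exists m, x - y = f m.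
Proof. by split => [/eqmodP/asboolP|h] //; apply/eqmodP/asboolP. Qed.

Definition coker_zero : coker := \pi_coker 0.
Definition coker_opp (x : coker) : coker := \pi_coker (- repr x).
Definition coker_add (x y : coker) : coker := \pi_coker (repr x + repr y).
Definition coker_scale (a : R) (x : coker) : coker := \pi_coker (a *: repr x).

Lemma coker_repr x : exists m, repr (\pi_coker x) = x + f m.
Proof.
have /coker_eq[m e] : \pi_coker (repr (\pi_coker x)) = \pi_coker x by rewrite reprK.
by exists m; rewrite -e addrC subrK.
Qed.

Lemma coker_oppE x : coker_opp (\pi_coker x) = \pi_coker (- x).
Proof.
rewrite /coker_opp; have [m ->] := coker_repr x.
by apply/coker_eq; exists (- m); rewrite opprD opprK addrAC addNr add0r linearN.
Qed.

Lemma coker_addE x y :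
  coker_add (\pi_coker x) (\pi_coker y) = \pi_coker (x + y).
Proof.
rewrite /coker_add; have [m ->] := coker_repr x; have [n ->] := coker_repr y.
by apply/coker_eq; exists (m + n); rewrite addrACA [X in X - _]addrC addrK linearD.
Qed.

Lemma coker_scaleE a x : coker_scale a (\pi_coker x) = \pi_coker (a *: x).
Proof.
rewrite /coker_scale; have [m ->] := coker_repr x.
by apply/coker_eq; exists (a *: m); rewrite scalerDr addrAC subrr add0r linearZ.
Qed.

Lemma coker_addA : associative coker_add.
Proof.
move=> x y z; elim/coker_ind: x => x; elim/coker_ind: y => y; elim/coker_ind: z => z.
by rewrite !coker_addE addrA.
Qed.
Lemma coker_addC : commutative coker_add.
Proof.
by move=> x y; elim/coker_ind: x => x; elim/coker_ind: y => y; rewrite !coker_addE addrC.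
Qed.
Lemma coker_add0 : left_id coker_zero coker_add.
Proof. by move=> x; elim/coker_ind: x => x; rewrite !coker_addE add0r. Qed.
Lemma coker_addN : left_inverse coker_zero coker_opp coker_add.
Proof. by move=> x; elim/coker_ind: x => x; rewrite coker_oppE !coker_addE addNr. Qed.

HB.instance Definition _ :=
  GRing.isZmodule.Build coker coker_addA coker_addC coker_add0 coker_addN.

Lemma coker_scaleA a b v :
  coker_scale a (coker_scale b v) = coker_scale (a * b) v.
Proof. by elim/coker_ind: v => x; rewrite !coker_scaleE scalerA. Qed.
Lemma coker_scale1 : left_id 1 coker_scale.
Proof. by move=> x; elim/coker_ind: x => x; rewrite coker_scaleE scale1r. Qed.
Lemma coker_scaleDr : right_distributive coker_scale +%R.
Proof.
move=> a x y; elim/coker_ind: x => x; elim/coker_ind: y => y.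
by rewrite /GRing.add /= !(coker_scaleE, coker_addE) scalerDr.
Qed.
Lemma coker_scaleDl v : {morph coker_scale^~ v : a b / a + b}.
Proof.
move=> a b; elim/coker_ind: v => x.
by rewrite [RHS]/GRing.add /= !(coker_scaleE, coker_addE) scalerDl.
Qed.

HB.instance Definition _ := GRing.Zmodule_isLmodule.Build R coker
  coker_scaleA coker_scale1 coker_scaleDr coker_scaleDl.

Definition coker_proj (x : N) : coker := \pi_coker x.

Lemma coker_proj_linear : linear coker_proj.
Proof.
move=> a x y; rewrite [RHS]/GRing.add /= [X in coker_add X _]/GRing.scale /=.
by rewrite coker_scaleE coker_addE.
Qed.

HB.instance Definition _ :=
  GRing.isLinear.Build R N coker *:%R coker_proj coker_proj_linear.

Lemma coker_proj_im m : coker_proj (f m) = 0.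
Proof. by apply/coker_eq; exists m; rewrite subr0. Qed.

Lemma coker_proj_ext (P : lmodType R) (g h : {linear coker -> P}) :
  g \o coker_proj =1 h \o coker_proj -> g =1 h.
Proof. by move=> gh; elim/coker_ind => x; exact: gh. Qed.

Lemma coker_lift_subproof (P : lmodType R) (g : {linear N -> P}) :
  (forall m, g (f m) = 0) ->
  exists h : {linear coker -> P}, forall x, h (coker_proj x) = g x.
Proof.
move=> gf0; pose h (x : coker) := g (repr x).
have hE x : h (coker_proj x) = g x.
  by rewrite /h /=; have [m ->] := coker_repr x; rewrite linearD gf0 addr0.
have hL : linear h.
  move=> a x y; elim/coker_ind: x => x; elim/coker_ind: y => y.
  have -> : a *: \pi_coker x + \pi_coker y = coker_proj (a *: x + y).
    by rewrite linearP.
  by rewrite hE linearP -!hE.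
by exists (mk_linear hL).
Qed.

End Coker.

Definition restr (R S : pzRingType) (pi : {rmorphism R -> S}) (N : lmodType S) :
  Type := N.

Section Restriction.
Context (R S : pzRingType) (pi : {rmorphism R -> S}).

Section RestrModule.
Context (N : lmodType S).

HB.instance Definition _ := GRing.Zmodule.copy (restr pi N) N.

Definition restr_scale (r : R) (x : restr pi N) : restr pi N := (pi r : S) *: (x : N).

Lemma restr_scaleA a b v :
  restr_scale a (restr_scale b v) = restr_scale (a * b) v.
Proof. by rewrite /restr_scale scalerA rmorphM. Qed.
Lemma restr_scale1 : left_id 1 restr_scale.
Proof. by move=> x; rewrite /restr_scale rmorph1 scale1r. Qed.
Lemma restr_scaleDr : right_distributive restr_scale +%R.
Proof. by move=> a x y; rewrite /restr_scale scalerDr. Qed.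
Lemma restr_scaleDl v : {morph restr_scale^~ v : a b / a + b}.
Proof. by move=> a b; rewrite /restr_scale rmorphD scalerDl. Qed.

HB.instance Definition _ := GRing.Zmodule_isLmodule.Build R (restr pi N)
  restr_scaleA restr_scale1 restr_scaleDr restr_scaleDl.

End RestrModule.

Definition restr_map (N1 N2 : lmodType S) (f : {linear N1 -> N2}) :
  restr pi N1 -> restr pi N2 := f.

Lemma restr_map_linear (N1 N2 : lmodType S) (f : {linear N1 -> N2}) :
  linear (restr_map f).
Proof.
by move=> a x y; rewrite /GRing.scale /= /restr_scale; exact: linearP.
Qed.

HB.instance Definition _ (N1 N2 : lmodType S) (f : {linear N1 -> N2}) :=
  GRing.isLinear.Build R (restr pi N1) (restr pi N2) *:%R (restr_map f)
    (restr_map_linear f).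

End Restriction.

Arguments restr_map {R S} pi {N1 N2} f _.

(* The left S-module S ⊗_R M, S being an S-R-bimodule through pi.  The list
   [:: (s1, m1); ...; (sn, mn)] stands for s1 ⊗ m1 + ... + sn ⊗ mn, and
   [tensor_eq] is the least congruence that makes ⊗ biadditive and R-balanced
   and the sum commutative.  No formal negatives are needed: the opposite of
   s ⊗ m is (- s) ⊗ m. *)
Section Tensor.
Context (R S : pzRingType) (pi : {rmorphism R -> S}).

Section TensorModule.
Context (M : lmodType R).

Inductive tensor_eq : seq (S * M) -> seq (S * M) -> Prop :=
| tensor_refl l : tensor_eq l l
| tensor_sym l l' : tensor_eq l l' -> tensor_eq l' l
| tensor_trans l l' l'' :
    tensor_eq l l' -> tensor_eq l' l'' -> tensor_eq l l''
| tensor_cat l1 l1' l2 l2' :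
    tensor_eq l1 l1' -> tensor_eq l2 l2' -> tensor_eq (l1 ++ l2) (l1' ++ l2')
| tensor_comm l l' : tensor_eq (l ++ l') (l' ++ l)
| tensor_0l m : tensor_eq [:: (0, m)] [::]
| tensor_Dl s s' m : tensor_eq [:: (s + s', m)] [:: (s, m); (s', m)]
| tensor_Dr s m m' : tensor_eq [:: (s, m + m')] [:: (s, m); (s, m')]
| tensor_bal s r m : tensor_eq [:: (s * pi r, m)] [:: (s, r *: m)].

Definition tensor_rel (l l' : seq (S * M)) : bool := `[< tensor_eq l l' >].

Lemma tensor_rel_refl : reflexive tensor_rel.
Proof. by move=> l; apply/asboolP; exact: tensor_refl. Qed.
Lemma tensor_rel_sym : symmetric tensor_rel.
Proof. by move=> l l'; apply/asboolP/asboolP; exact: tensor_sym. Qed.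
Lemma tensor_rel_trans : transitive tensor_rel.
Proof.
move=> l' l l'' /asboolP h /asboolP h'; apply/asboolP.
exact: tensor_trans h h'.
Qed.

Canonical tensor_equiv :=
  EquivRel tensor_rel tensor_rel_refl tensor_rel_sym tensor_rel_trans.

Definition tensor : Type := {eq_quot tensor_equiv}.
HB.instance Definition _ := Choice.on tensor.
HB.instance Definition _ := EqQuotient.on tensor.

Lemma tensor_ind (P : tensor -> Prop) :
  (forall l, P (\pi_tensor l)) -> forall x, P x.
Proof. by move=> h x; rewrite -[x]reprK. Qed.

Lemma tensor_eqP l l' : (\pi_tensor l = \pi_tensor l') <-> tensor_eq l l'.
Proof. by split => [/eqmodP/asboolP|h] //; apply/eqmodP/asboolP. Qed.

Lemma tensor_repr l : tensor_eq (repr (\pi_tensor l)) l.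
Proof. by apply/tensor_eqP; rewrite reprK. Qed.

Definition lscale (a : S) (l : seq (S * M)) : seq (S * M) :=
  [seq (a * p.1, p.2) | p <- l].

Lemma lscale_eq a l l' : tensor_eq l l' -> tensor_eq (lscale a l) (lscale a l').
Proof.
elim=> {l l'} [l|l l' _|l l' l'' _ h _ h'|l1 l1' l2 l2' _ h _ h'|l l'|m|s s' m
  |s m m'|s r m]; rewrite /lscale ?map_cat /=.
- exact: tensor_refl.
- exact: tensor_sym.
- exact: tensor_trans h h'.
- exact: tensor_cat.
- exact: tensor_comm.
- by rewrite mulr0; exact: tensor_0l.
- by rewrite mulrDr; exact: tensor_Dl.
- exact: tensor_Dr.
- by rewrite mulrA; exact: tensor_bal.
Qed.

Lemma lscale_addl a b l :
  tensor_eq (lscale (a + b) l) (lscale a l ++ lscale b l).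
Proof.
elim: l => [|[s m] l IHl]; first exact: tensor_refl.
have h1 : tensor_eq [:: ((a + b) * s, m)] [:: (a * s, m); (b * s, m)].
  by rewrite mulrDl; exact: tensor_Dl.
have h2 := tensor_cat h1 IHl; rewrite /= in h2.
apply: tensor_trans h2 _; rewrite /= -cat1s -[X in tensor_eq _ X]cat1s.
apply: tensor_cat; first exact: tensor_refl.
rewrite -cat_cons -cat_rcons; apply: tensor_cat; last exact: tensor_refl.
by rewrite -cats1 -cat1s; exact: tensor_comm.
Qed.

Lemma lscale0 l : tensor_eq (lscale 0 l) [::].
Proof.
elim: l => [|[s m] l IHl] /=; first exact: tensor_refl.
rewrite mul0r -cat1s -[X in tensor_eq _ X]cats0.
by apply: tensor_cat => //; exact: tensor_0l.
Qed.

Lemma lscale1 l : lscale 1 l = l.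
Proof.
by rewrite -[RHS]map_id; apply: eq_map => -[s m] /=; rewrite mul1r.
Qed.

Definition tensor_zero : tensor := \pi_tensor [::].
Definition tensor_opp (x : tensor) : tensor := \pi_tensor (lscale (-1) (repr x)).
Definition tensor_add (x y : tensor) : tensor := \pi_tensor (repr x ++ repr y).
Definition tensor_scale (a : S) (x : tensor) : tensor :=
  \pi_tensor (lscale a (repr x)).

Lemma tensor_scaleE a l : tensor_scale a (\pi_tensor l) = \pi_tensor (lscale a l).
Proof. by apply/tensor_eqP/lscale_eq/tensor_repr. Qed.

Lemma tensor_addE l l' :
  tensor_add (\pi_tensor l) (\pi_tensor l') = \pi_tensor (l ++ l').
Proof. by apply/tensor_eqP/tensor_cat; exact: tensor_repr. Qed.

Lemma tensor_addA : associative tensor_add.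
Proof.
move=> x y z; elim/tensor_ind: x => x; elim/tensor_ind: y => y; elim/tensor_ind: z => z.
by rewrite !tensor_addE catA.
Qed.
Lemma tensor_addC : commutative tensor_add.
Proof.
move=> x y; elim/tensor_ind: x => x; elim/tensor_ind: y => y; rewrite !tensor_addE.
by apply/tensor_eqP; exact: tensor_comm.
Qed.
Lemma tensor_add0 : left_id tensor_zero tensor_add.
Proof. by move=> x; elim/tensor_ind: x => x; rewrite !tensor_addE. Qed.
Lemma tensor_addN : left_inverse tensor_zero tensor_opp tensor_add.
Proof.
move=> x; elim/tensor_ind: x => x; rewrite -[tensor_opp _]/(tensor_scale _ _) tensor_scaleE.
rewrite tensor_addE; apply/tensor_eqP.
rewrite -[X in _ ++ X]lscale1; apply: tensor_trans (lscale0 x).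
by rewrite -(addNr 1); apply/tensor_sym/lscale_addl.
Qed.

HB.instance Definition _ := GRing.isZmodule.Build tensor
  tensor_addA tensor_addC tensor_add0 tensor_addN.

Lemma tensor_scaleA a b v :
  tensor_scale a (tensor_scale b v) = tensor_scale (a * b) v.
Proof.
elim/tensor_ind: v => x; rewrite !tensor_scaleE /lscale -map_comp.
by congr (\pi_ _ _); apply: eq_map => -[s m] /=; rewrite mulrA.
Qed.
Lemma tensor_scale1 : left_id 1 tensor_scale.
Proof. by move=> x; elim/tensor_ind: x => x; rewrite tensor_scaleE lscale1. Qed.
Lemma tensor_scaleDr : right_distributive tensor_scale +%R.
Proof.
move=> a x y; elim/tensor_ind: x => x; elim/tensor_ind: y => y.
by rewrite /GRing.add /= !(tensor_scaleE, tensor_addE) /lscale map_cat.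
Qed.
Lemma tensor_scaleDl v : {morph tensor_scale^~ v : a b / a + b}.
Proof.
move=> a b; elim/tensor_ind: v => x.
rewrite [RHS]/GRing.add /= !(tensor_scaleE, tensor_addE).
by apply/tensor_eqP; exact: lscale_addl.
Qed.

HB.instance Definition _ := GRing.Zmodule_isLmodule.Build S tensor
  tensor_scaleA tensor_scale1 tensor_scaleDr tensor_scaleDl.

Definition pure (s : S) (m : M) : tensor := \pi_tensor [:: (s, m)].

Lemma tensor_piE l : \pi_tensor l = \sum_(p <- l) pure p.1 p.2.
Proof.
elim: l => [|[s m] l IHl]; first by rewrite big_nil.
by rewrite big_cons -IHl /= [RHS]/GRing.add /= tensor_addE.
Qed.

Lemma pureZ a s m : a *: pure s m = pure (a * s) m.
Proof. by rewrite /GRing.scale /= tensor_scaleE. Qed.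

Lemma pure_tensor s m : pure s m = s *: pure 1 m.
Proof. by rewrite pureZ mulr1. Qed.

Lemma tensor_ext (N : lmodType S) (f g : {linear tensor -> N}) :
  (forall m, f (pure 1 m) = g (pure 1 m)) -> f =1 g.
Proof.
move=> fg; elim/tensor_ind => l; rewrite tensor_piE !linear_sum.
by apply: eq_bigr => p _; rewrite pure_tensor !linearZ_LR fg.
Qed.

Definition tensor_unit : M -> restr pi tensor := pure 1.

Lemma tensor_unit_linear : linear tensor_unit.
Proof.
move=> r x y; rewrite [RHS]/GRing.add /= [X in tensor_add X _]/GRing.scale /=.
rewrite /restr_scale pureZ mulr1 tensor_addE; apply/tensor_eqP.
apply: tensor_trans (tensor_Dr _ _ _) _.
rewrite -cat1s; apply: tensor_cat; last exact: tensor_refl.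
by apply: tensor_sym; rewrite -[pi r]mul1r; exact: tensor_bal.
Qed.

HB.instance Definition _ := GRing.isLinear.Build R M (restr pi tensor) *:%R
  tensor_unit tensor_unit_linear.

Section Lift.
Context (N : lmodType S) (f : {linear M -> restr pi N}).

Definition lift_sum (l : seq (S * M)) : N := \sum_(p <- l) p.1 *: (f p.2 : N).

Lemma lift_sum_eq l l' : tensor_eq l l' -> lift_sum l = lift_sum l'.
Proof.
rewrite /lift_sum; elim=> {l l'} [l|l l' _|l l' l'' _ h _ h'
  |l1 l1' l2 l2' _ h _ h'|l l'|m|s s' m|s m m'|s r m] //.
- by rewrite h.
- by rewrite !big_cat /= h h'.
- by rewrite !big_cat /= addrC.
- by rewrite big_seq1 big_nil scale0r.
- by rewrite !(big_cons, big_nil) !addr0 scalerDl.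
- by rewrite !(big_cons, big_nil) !addr0 linearD scalerDr.
- by rewrite !(big_cons, big_nil) !addr0 linearZ -scalerA.
Qed.

Definition tensor_lift (x : tensor) : N := lift_sum (repr x).

Lemma tensor_liftE l : tensor_lift (\pi_tensor l) = lift_sum l.
Proof. exact/lift_sum_eq/tensor_repr. Qed.

Lemma tensor_lift_linear : linear tensor_lift.
Proof.
move=> a x y; elim/tensor_ind: x => x; elim/tensor_ind: y => y.
rewrite [X in tensor_lift X]/GRing.add /= [X in tensor_add X _]/GRing.scale /=.
rewrite tensor_scaleE tensor_addE !tensor_liftE /lift_sum big_cat /= big_map.
by rewrite scaler_sumr; congr (_ + _); apply: eq_bigr => p _; rewrite scalerA.
Qed.

HB.instance Definition _ := GRing.isLinear.Build S tensor N *:%R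
  tensor_lift tensor_lift_linear.

Lemma tensor_lift_pure s m : tensor_lift (pure s m) = s *: (f m : N).
Proof. by rewrite tensor_liftE /lift_sum big_seq1. Qed.

End Lift.

End TensorModule.

(* id_S ⊗ f *)
Definition tensor_map (M N : lmodType R) (f : {linear M -> N}) :
    tensor M -> tensor N :=
  tensor_lift (@tensor_unit N \o f).

HB.instance Definition _ (M N : lmodType R) (f : {linear M -> N}) :=
  GRing.Linear.copy (tensor_map f) (tensor_lift (@tensor_unit N \o f)).

Lemma tensor_mapE (M N : lmodType R) (f : {linear M -> N}) s m :
  tensor_map f (pure s m) = pure s (f m).
Proof. by rewrite /tensor_map tensor_lift_pure /= -pure_tensor. Qed.

Lemma tensor_map_id (M : lmodType R) : tensor_map (@idfun M) =1 idfun.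
Proof. by apply: tensor_ext => m; rewrite /= tensor_mapE. Qed.

Lemma tensor_map_comp (M N P : lmodType R) (f : {linear M -> N})
  (g : {linear N -> P}) : tensor_map (g \o f) =1 tensor_map g \o tensor_map f.
Proof. by apply: tensor_ext => m; rewrite /= !tensor_mapE. Qed.

End Tensor.

Arguments tensor_unit {R S} pi M _.
Arguments tensor_map {R S} pi {M N} f _.

Section DirectSum.
Context (R : pzRingType) (M1 M2 N1 N2 : lmodType R).
Context (f : {linear M1 -> N1}) (g : {linear M2 -> N2}).

Definition dsum (x : M1 * M2) : N1 * N2 := (f x.1, g x.2).

Lemma dsum_linear : linear dsum.
Proof. by move=> a x y; rewrite /dsum /= !linearP. Qed.

HB.instance Definition _ := GRing.isLinear.Build R (M1 * M2)%type (N1 * N2)%type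
  *:%R dsum dsum_linear.

End DirectSum.

Definition fin_gen (R : pzRingType) (M : lmodType R) : Prop :=
  exists n (e : 'I_n -> M),
    forall x, exists c : 'I_n -> R, x = \sum_(i < n) c i *: e i.

Definition directed d (J : preorderType d) : Prop :=
  inhabited J /\ forall i j : J, exists k : J, (i <= k)%O /\ (j <= k)%O.

(* The filter of "j tending to infinity" on a directed set. *)
Definition tails d (J : preorderType d) : set_system J :=
  filter_from setT (fun i : J => [set j | (i <= j)%O]).

Arguments tails {d} J.

Record direct_system (R : pzRingType) d (J : preorderType d) := DirectSystem {
  ds_obj :> J -> lmodType R;
  ds_map : forall j k : J, (j <= k)%O -> {linear ds_obj j -> ds_obj k};
  ds_id : forall (j : J) (h : (j <= j)%O), ds_map h =1 idfun;
  ds_comp : forall (i j k : J) (hij : (i <= j)%O) (hjk : (j <= k)%O)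
    (hik : (i <= k)%O), ds_map hjk \o ds_map hij =1 ds_map hik
}.

Definition cocone (R : pzRingType) d (J : preorderType d)
    (D : direct_system R J) (L : lmodType R)
    (b : forall j : J, {linear D j -> L}) : Prop :=
  forall (j k : J) (h : (j <= k)%O), b k \o ds_map D h =1 b j.

Definition is_direct_limit (R : pzRingType) d (J : preorderType d)
    (D : direct_system R J) (L : lmodType R)
    (b : forall j : J, {linear D j -> L}) : Prop :=
  cocone b /\
  forall (N : lmodType R) (c : forall j : J, {linear D j -> N}), cocone c ->
    exists g : {linear L -> N}, (forall j : J, g \o b j =1 c j) /\
      forall g' : {linear L -> N}, (forall j : J, g' \o b j =1 c j) -> g' =1 g.

Definition rank_fun (K : realType) (R : pzRingType) : Type :=
  forall M N : lmodType R, {linear M -> N} -> \bar K.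

Record is_ext_sylvester (K : realType) (R : pzRingType) (rk : rank_fun K R) :
    Prop := IsExtSylvester {
  rk_ge0 : forall (M N : lmodType R) (f : {linear M -> N}),
    (0 <= rk M N f)%E;
  rk_0 : forall M N : lmodType R, rk M N \0 = 0%E;
  rk_1 : rk R^o R^o idfun = 1%E;
  rk_comp : forall (M N P : lmodType R) (f : {linear M -> N})
      (g : {linear N -> P}),
    (rk M P (g \o f) <= Order.min (rk M N f) (rk N P g))%E;
  rk_dsum : forall (M1 M2 N1 N2 : lmodType R) (f : {linear M1 -> N1})
      (g : {linear M2 -> N2}),
    rk _ _ (dsum f g) = (rk M1 N1 f + rk M2 N2 g)%E;
  rk_colim_dom : forall d (J : preorderType d) (D : direct_system R J)
      (L : lmodType R) (b : forall j : J, {linear D j -> L}),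
    directed J -> is_direct_limit b ->
    forall (M : lmodType R) (a : forall j : J, {linear D j -> M})
      (a_oo : {linear L -> M}),
    (forall (j k : J) (h : (j <= k)%O), a k \o ds_map D h =1 a j) ->
    (forall j : J, a_oo \o b j =1 a j) ->
    rk _ _ (a j) @[j --> tails J] --> rk _ _ a_oo;
  rk_colim_codom : forall d (J : preorderType d) (D : direct_system R J)
      (L : lmodType R) (b : forall j : J, {linear D j -> L}),
    directed J -> is_direct_limit b ->
    forall (M : lmodType R) (a : forall j : J, {linear M -> D j})
      (a_oo : {linear M -> L}),
    fin_gen M ->
    (forall (j k : J) (h : (j <= k)%O), ds_map D h \o a j =1 a k) ->
    (forall j : J, b j \o a j =1 a_oo) ->
    rk _ _ (a j) @[j --> tails J] --> rk _ _ a_oo;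
  rk_coker : forall (M N : lmodType R) (f : {linear M -> N}),
    rk N N idfun = (rk M N f + rk (coker f) (coker f) idfun)%E
}.

(* The set P(R) of the paper; pi^* is [pullback pi] below. *)
Record ext_sylvester (K : realType) (R : pzRingType) := ExtSylvester {
  rank :> forall M N : lmodType R, {linear M -> N} -> \bar K;
  rankP : is_ext_sylvester rank
}.

Lemma ext_sylvester_eq (K : realType) (R : pzRingType)
  (rk1 rk2 : ext_sylvester K R) :
  (forall (M N : lmodType R) (f : {linear M -> N}), rk1 M N f = rk2 M N f) ->
  rk1 = rk2.
Proof.
case: rk1 rk2 => [rk1 h1] [rk2 h2] /= e.
have e' : rk1 = rk2.
  by apply: functional_extensionality_dep => M;
     apply: functional_extensionality_dep => N; apply: funext => f; exact: e.
by subst rk2; rewrite (Prop_irrelevance h1 h2).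
Qed.

Lemma rk_iso (K : realType) (R : pzRingType) (rk : rank_fun K R)
    (M1 M2 N1 N2 : lmodType R) (f : {linear M1 -> N1}) (g : {linear M2 -> N2})
    (a : {linear M1 -> M2}) (a' : {linear M2 -> M1})
    (b : {linear N1 -> N2}) (b' : {linear N2 -> N1}) :
  is_ext_sylvester rk -> cancel a a' -> cancel a' a ->
  cancel b b' -> cancel b' b -> b \o f =1 g \o a -> rk _ _ f = rk _ _ g.
Proof.
move=> rkP aK a'K bK b'K e.
have le (X1 X2 X3 X4 : lmodType R) (u : {linear X1 -> X2})
    (v : {linear X2 -> X3}) (w : {linear X3 -> X4}) :
  (rk _ _ (w \o (v \o u)) <= rk _ _ v)%E.
  have := rk_comp rkP (v \o u) w; rewrite le_min => /andP[h _].
  apply: le_trans h _.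
  by have := rk_comp rkP u v; rewrite le_min => /andP[].
apply/eqP; rewrite eq_le; apply/andP; split.
- have -> : f = b' \o (g \o a) :> {linear _ -> _}.
    by apply: linear_ext => x /=; rewrite -[g _](e x) /= bK.
  exact: le.
- have -> : g = b \o (f \o a') :> {linear _ -> _}.
    by apply: linear_ext => x /=; rewrite [b _](e (a' x)) /= a'K.
  exact: le.
Qed.

Section Pullback.
Context (K : realType) (R S : pzRingType) (pi : {rmorphism R -> S}).

Definition pullback_fun (rk : rank_fun K S) : rank_fun K R :=
  fun M N f => rk _ _ (tensor_map pi f).

Lemma tensor_id_iso (M : lmodType R) :
  tensor_map pi (@idfun M) = @idfun (tensor pi M) :> {linear _ -> _}.
Proof. by apply: linear_ext; exact: tensor_map_id. Qed.

Definition tensor_system d (J : preorderType d) (D : direct_system R J) :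
  direct_system S J.
Proof.
apply: (@DirectSystem S d J (fun j => tensor pi (D j))
  (fun j k h => tensor_map pi (ds_map D h))) => [j h|i j k hij hjk hik].
- by apply: tensor_ext => m; rewrite /= tensor_mapE ds_id.
- by apply: tensor_ext => m; rewrite /= !tensor_mapE -(ds_comp hij hjk hik).
Defined.

Lemma tensor_limit d (J : preorderType d) (D : direct_system R J)
    (L : lmodType R) (b : forall j : J, {linear D j -> L}) :
  is_direct_limit b ->
  is_direct_limit (D := tensor_system D) (fun j => tensor_map pi (b j)).
Proof.
move=> [bD bU]; split => [j k h|N c cD].
  by apply: tensor_ext => m; rewrite /= !tensor_mapE -(bD j k h).
pose c' j : {linear D j -> restr pi N} :=
  restr_map pi (c j) \o tensor_unit pi (D j).
have c'D : cocone c'.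
  move=> j k h m; rewrite /c' /= -(cD j k h) /=.
  by congr (c k _); rewrite tensor_mapE.
have [g [gb gU]] := bU _ _ c'D; exists (tensor_lift g); split => [j|g' g'b].
  by apply: tensor_ext => m; rewrite /= tensor_mapE tensor_lift_pure scale1r;
    exact: gb.
apply: tensor_ext => m; rewrite /= tensor_lift_pure scale1r.
have := gU (restr_map pi g' \o tensor_unit pi L); apply => j x /=.
by rewrite /c' /= -(g'b j) /= tensor_mapE.
Qed.

Lemma tensor_fin_gen (M : lmodType R) : fin_gen M -> fin_gen (tensor pi M).
Proof.
move=> [n [e he]]; exists n, (fun i => pure pi 1 (e i)).
elim/tensor_ind => l; rewrite tensor_piE.
elim: l => [|[s m] l [c IHl]].
  by exists (fun=> 0); rewrite big_nil big1 // => i _; rewrite scale0r.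
have [c' ->] := he m; exists (fun i => s * pi (c' i) + c i).
rewrite big_cons IHl /= pure_tensor -[pure _ 1 _]/(tensor_unit pi M _).
rewrite linear_sum scaler_sumr -big_split /=; apply: eq_bigr => i _.
by rewrite linearZ /= scalerDl -scalerA.
Qed.

Lemma pullback_subproof (rk : rank_fun K S) :
  is_ext_sylvester rk -> is_ext_sylvester (pullback_fun rk).
Proof.
move=> rkP; rewrite /pullback_fun; split.
- by move=> M N f; exact: rk_ge0.
- move=> M N; rewrite -(rk_0 rkP (tensor pi M) (tensor pi N)).
  congr (rk _ _ _); apply: linear_ext; apply: tensor_ext => m.
  by rewrite /= tensor_mapE; exact: (linear0 (tensor_unit pi N)).
- rewrite tensor_id_iso -(rk_1 rkP).
  have uL : linear ((fun r => pi r) : R^o -> restr pi S^o).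
    by move=> a x y; rewrite rmorphD rmorphM.
  have vL : linear ((fun s => @pure R S pi R^o s (1 : R)) : S^o -> tensor pi R^o).
    by move=> a x y; rewrite [LHS]pure_tensor scalerDl -scalerA -!pure_tensor.
  have uv : cancel (tensor_lift (mk_linear uL)) (mk_linear vL).
    move=> x; rewrite -[LHS]/((mk_linear vL \o tensor_lift (mk_linear uL)) x).
    apply: (tensor_ext (g := idfun)) x => m.
    rewrite /= tensor_lift_pure scale1r /=.
    apply/tensor_eqP; rewrite -[pi m]mul1r -[in X in tensor_eq _ _ X](mulr1 m).
    exact: tensor_bal.
  have vu : cancel (mk_linear vL) (tensor_lift (mk_linear uL)).
    by move=> s; rewrite /= tensor_lift_pure /= rmorph1 -[_ *: _]/(_ * _) mulr1.
  exact: (rk_iso rkP uv vu uv vu).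
- move=> M N P f g.
  have -> : tensor_map pi (g \o f) = tensor_map pi g \o tensor_map pi f
    :> {linear _ -> _} by apply: linear_ext; exact: tensor_map_comp.
  exact: rk_comp.
- move=> M1 M2 N1 N2 f g; rewrite -(rk_dsum rkP).
  have pL (X Y : lmodType R) : linear (fun x : tensor pi (X * Y)%type =>
      (tensor_map pi (@fst X Y) x, tensor_map pi (@snd X Y) x)).
    by move=> a x y; rewrite !linearP.
  have iL (X Y : lmodType R) : linear (fun x : X => (x, 0 : Y)).
    by move=> a x y; congr (_, _); rewrite /= scaler0 addr0.
  have jL (X Y : lmodType R) : linear (fun y : Y => (0 : X, y)).
    by move=> a x y; congr (_, _); rewrite /= scaler0 addr0.
  have qL (X Y : lmodType R) :
    linear (fun x : (tensor pi X * tensor pi Y)%type =>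
      tensor_map pi (mk_linear (iL X Y)) x.1
      + tensor_map pi (mk_linear (jL X Y)) x.2).
    by move=> a x y; rewrite !linearP scalerDr addrACA.
  have pq X Y : cancel (mk_linear (pL X Y)) (mk_linear (qL X Y)).
    move=> x; rewrite -[LHS]/((mk_linear (qL X Y) \o mk_linear (pL X Y)) x).
    apply: (tensor_ext (g := idfun)) x => -[x y] /=.
    rewrite !tensor_mapE /=.
    rewrite -![pure _ 1 _]/(tensor_unit pi _ _) -linearD.
    by congr (tensor_unit pi _ _); congr (_, _); rewrite /= ?addr0 ?add0r.
  have qp X Y : cancel (mk_linear (qL X Y)) (mk_linear (pL X Y)).
    have mm (X1 X2 X3 : lmodType R) (u : {linear X1 -> X2})
        (v : {linear X2 -> X3}) (w : {linear tensor pi X1 -> tensor pi X3}) :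
        (forall m, pure pi 1 (v (u m)) = w (pure pi 1 m)) ->
        forall x, tensor_map pi v (tensor_map pi u x) = w x.
      move=> h x; rewrite -[LHS]/((tensor_map pi v \o tensor_map pi u) x).
      by apply: tensor_ext x => m /=; rewrite !tensor_mapE.
    move=> [x y] /=; congr (_, _); rewrite linearD.
      transitivity (x + 0); last by rewrite addr0.
      congr (_ + _).
        exact: (mm _ _ _ (mk_linear (iL X Y)) (@fst X Y) idfun).
      apply: (mm _ _ _ (mk_linear (jL X Y)) (@fst X Y) \0) => m.
      exact: (linear0 (tensor_unit pi X)).
    transitivity (0 + y); last by rewrite add0r.
    congr (_ + _).
      apply: (mm _ _ _ (mk_linear (iL X Y)) (@snd X Y) \0) => m.
      exact: (linear0 (tensor_unit pi Y)).
    exact: (mm _ _ _ (mk_linear (jL X Y)) (@snd X Y) idfun).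
  apply: (rk_iso rkP (@pq M1 M2) (@qp M1 M2) (@pq N1 N2) (@qp N1 N2)).
  apply: (tensor_ext (f := mk_linear (pL N1 N2) \o tensor_map pi (dsum f g))
    (g := dsum (tensor_map pi f) (tensor_map pi g) \o mk_linear (pL M1 M2))).
  by move=> [x y]; rewrite /= /dsum /= !tensor_mapE.
- move=> d J D L b dJ bL M a a_oo aD aL.
  apply: (rk_colim_dom rkP dJ (tensor_limit bL)
    (a := fun j => tensor_map pi (a j))) => [j k h|j].
  + by apply: tensor_ext => m; rewrite /= !tensor_mapE -(aD j k h).
  + by apply: tensor_ext => m; rewrite /= !tensor_mapE -(aL j).
- move=> d J D L b dJ bL M a a_oo fM aD aL.
  apply: (@rk_colim_codom _ _ _ rkP d J (tensor_system D) (tensor pi L) _ dJ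
    (tensor_limit bL) (tensor pi M) (fun j => tensor_map pi (a j))
    (tensor_map pi a_oo) (tensor_fin_gen fM)) => [j k h|j].
  + by apply: tensor_ext => m; rewrite /= !tensor_mapE -(aD j k h).
  + by apply: tensor_ext => m; rewrite /= !tensor_mapE -(aL j).
- move=> M N f; rewrite !tensor_id_iso (rk_coker rkP (tensor_map pi f)).
  congr (_ + _)%E.
  have [u uE] : exists u : {linear coker (tensor_map pi f) ->
      tensor pi (coker f)},
      forall x, u (coker_proj _ x) = tensor_map pi (coker_proj f) x.
    apply: coker_lift_subproof => x.
    rewrite -[LHS]/((tensor_map pi (coker_proj f) \o tensor_map pi f) x).
    apply: (tensor_ext (g := \0)) x => m; rewrite /= !tensor_mapE /= coker_proj_im.
    exact: (linear0 (tensor_unit pi _)).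
  have [v vE] : exists v : {linear coker f ->
      restr pi (coker (tensor_map pi f))},
      forall x, v (coker_proj f x) = coker_proj (tensor_map pi f) (pure pi 1 x).
    apply: (coker_lift_subproof (g :=
      restr_map pi (coker_proj (tensor_map pi f)) \o tensor_unit pi N)) => m.
    by rewrite -(coker_proj_im (tensor_map pi f) (pure pi 1 m)) /= tensor_mapE.
  have uv : cancel u (tensor_lift v).
    move=> x; rewrite -[LHS]/((tensor_lift v \o u) x).
    apply: (coker_proj_ext (h := idfun)) x => x.
    rewrite -[LHS]/((tensor_lift v \o (u \o coker_proj _)) x).
    apply: (tensor_ext (g := coker_proj _)) x => m.
    by rewrite /= uE tensor_mapE tensor_lift_pure scale1r vE.
  have vu : cancel (tensor_lift v) u.
    move=> x; rewrite -[LHS]/((u \o tensor_lift v) x).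
    apply: (tensor_ext (g := idfun)) x.
    elim/coker_ind => m; rewrite /= tensor_lift_pure scale1r.
    by rewrite -[\pi_ _ m]/(coker_proj f m) vE uE tensor_mapE.
  exact: (rk_iso rkP uv vu uv vu).
Qed.

Definition pullback (rk : ext_sylvester K S) : ext_sylvester K R :=
  ExtSylvester (pullback_subproof (rankP rk)).

End Pullback.

(* Main.v *)
Require Import Defs.
From HB Require Import structures.
From mathcomp Require Import all_boot all_order all_algebra.
From mathcomp Require Import all_classical all_reals all_analysis.
Local Open Scope ring_scope.

(** If [pi] is an epimorphism then [s ⊗ 1 = 1 ⊗ s] in the bimodule
    [B = S ⊗_R S]: the maps [s ↦ (s, 0)] and [s ↦ (s, s ⊗ 1 - 1 ⊗ s)] from [S]
    to the trivial extension [S ⋉ B] are ring homomorphisms which agree on the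
    image of [R].  Hence [s ⊗ x = 1 ⊗ s x] in [S ⊗_R N] for every S-module [N],
    so the multiplication [S ⊗_R N -> N] is an isomorphism, natural in [N], and
    ranks are invariant under isomorphism. *)

Set Implicit Arguments.
Unset Strict Implicit.
Unset Printing Implicit Defensive.

Import GRing.Theory.

Section Bimodule.
Context (R S : pzRingType) (pi : {rmorphism R -> S}).

Definition self_tensor : Type := tensor pi (restr pi S^o).
HB.instance Definition _ := GRing.Lmodule.on self_tensor.

Definition orbit_map (N : lmodType S) (x : N) (s : S^o) : N := (s : S) *: x.

Lemma orbit_map_linear (N : lmodType S) (x : N) : linear (orbit_map x).
Proof. by move=> a s t; rewrite /orbit_map scalerDl -scalerA. Qed.

HB.instance Definition _ (N : lmodType S) (x : N) :=
  GRing.isLinear.Build S S^o N *:%R (orbit_map x) (orbit_map_linear x).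

(** The map [id ⊗ (t ↦ t x)], which carries identities in [S ⊗_R S] over to [S ⊗_R N]. *)
Definition self_tensor_eval (N : lmodType S) (x : N) :
    {linear self_tensor -> tensor pi (restr pi N)} :=
  @tensor_map R S pi (restr pi S^o) (restr pi N) (restr_map pi (orbit_map x)).

Lemma self_tensor_evalE (N : lmodType S) (x : N) (a b : S) :
  self_tensor_eval x (@pure R S pi (restr pi S^o) a b)
  = @pure R S pi (restr pi N) a (b *: x).
Proof. exact: tensor_mapE. Qed.

(** The right S-action on [S ⊗_R S]: [t ↦ t s] respects left scalars, so it may be applied to the
    second factor. *)
Definition self_tensor_mulr (s : S) : {linear self_tensor -> self_tensor} :=
  @self_tensor_eval S^o s.

Local Notation "a ⊗ b" := (@pure R S pi (restr pi S^o) a b : self_tensor)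
  (at level 40).

Lemma self_tensor_mulrE (s a b : S) : self_tensor_mulr s (a ⊗ b) = a ⊗ (b * s).
Proof. exact: self_tensor_evalE. Qed.

Lemma pure_addr (M : lmodType R) (s : S) (x y : M) :
  pure pi s (x + y) = pure pi s x + pure pi s y.
Proof.
by rewrite !(pure_tensor _ s) -scalerDr; congr (_ *: _);
  exact: (linearD (tensor_unit pi M)).
Qed.

Lemma self_tensor_mulr1 : self_tensor_mulr 1 =1 idfun.
Proof.
by apply: tensor_ext => m; rewrite self_tensor_mulrE mulr1.
Qed.

Lemma self_tensor_mulrM (s t : S) :
  self_tensor_mulr t \o self_tensor_mulr s =1 self_tensor_mulr (s * t).
Proof.
by apply: tensor_ext => m; rewrite /= !self_tensor_mulrE mulrA.
Qed.

Lemma self_tensor_mulrD (s t : S) :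
  self_tensor_mulr (s + t) =1 self_tensor_mulr s \+ self_tensor_mulr t.
Proof.
by apply: tensor_ext => m; rewrite /= !self_tensor_mulrE mulrDr pure_addr.
Qed.

Definition triv_ext : Type := (S * self_tensor)%type.
HB.instance Definition _ := GRing.Zmodule.on triv_ext.

Definition triv_one : triv_ext := (1, 0).
(** The summand [self_tensor] is an ideal of square zero, on which [S] acts from both sides. *)
Definition triv_mul (x y : triv_ext) : triv_ext :=
  (x.1 * y.1, x.1 *: y.2 + self_tensor_mulr y.1 x.2).

Lemma triv_mulA : associative triv_mul.
Proof.
move=> [a x] [b y] [c z]; rewrite /triv_mul /= mulrA; congr (_, _).
(* [linearZ_LR] is the bimodule law [(a y) c = a (y c)]. *)
rewrite scalerDr linearD linearZ_LR scalerA -addrA; congr (_ + (_ + _)).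
by rewrite -[LHS]self_tensor_mulrM.
Qed.

Lemma triv_mul1l : left_id triv_one triv_mul.
Proof. by move=> [a x]; rewrite /triv_mul /= mul1r scale1r linear0 addr0. Qed.

Lemma triv_mul1r : right_id triv_one triv_mul.
Proof.
by move=> [a x]; rewrite /triv_mul /= mulr1 scaler0 add0r self_tensor_mulr1.
Qed.

Lemma triv_mulDl : left_distributive triv_mul +%R.
Proof.
move=> [a x] [b y] [c z]; congr (_, _) => /=; first by rewrite mulrDl.
by rewrite scalerDl linearD addrACA.
Qed.

Lemma triv_mulDr : right_distributive triv_mul +%R.
Proof.
move=> [a x] [b y] [c z]; congr (_, _) => /=; first by rewrite mulrDr.
by rewrite scalerDr self_tensor_mulrD addrACA.
Qed.

HB.instance Definition _ := GRing.Zmodule_isPzRing.Build triv_ext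
  triv_mulA triv_mul1l triv_mul1r triv_mulDl triv_mulDr.

Definition triv_incl (s : S) : triv_ext := (s, 0).
Definition triv_twist (s : S) : triv_ext := (s, s ⊗ 1 - 1 ⊗ s).

Lemma triv_incl_zmod_morphism : zmod_morphism triv_incl.
Proof. by move=> s t; congr (_, _) => /=; rewrite subr0. Qed.

Lemma triv_incl_monoid_morphism : monoid_morphism triv_incl.
Proof.
by split=> // s t; congr (_, _) => /=; rewrite scaler0 linear0 addr0.
Qed.

HB.instance Definition _ :=
  GRing.isZmodMorphism.Build S triv_ext triv_incl triv_incl_zmod_morphism.
HB.instance Definition _ :=
  GRing.isMonoidMorphism.Build S triv_ext triv_incl triv_incl_monoid_morphism.

Lemma triv_twist_zmod_morphism : zmod_morphism triv_twist.
Proof.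
move=> s t; congr (_, _) => /=.
(* Additivity in the left factor is read off from [s ⊗ 1 = s *: (1 ⊗ 1)]. *)
rewrite pure_tensor scalerBl -!pure_tensor.
have -> : 1 ⊗ (s - t) = 1 ⊗ s - 1 ⊗ t.
  exact: (linearB (tensor_unit pi (restr pi S^o))).
by rewrite !opprB addrACA [RHS]addrACA; congr (_ + _); rewrite addrC.
Qed.

(* The Leibniz rule [st ⊗ 1 - 1 ⊗ st = s (t ⊗ 1 - 1 ⊗ t) + (s ⊗ 1 - 1 ⊗ s) t]. *)
Lemma triv_twist_monoid_morphism : monoid_morphism triv_twist.
Proof.
split=> [|s t]; congr (_, _) => /=; first by rewrite subrr.
rewrite scalerBr linearB /= !self_tensor_mulrE !pureZ mulr1 mul1r.
by rewrite addrA subrK.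
Qed.

HB.instance Definition _ :=
  GRing.isZmodMorphism.Build S triv_ext triv_twist triv_twist_zmod_morphism.
HB.instance Definition _ :=
  GRing.isMonoidMorphism.Build S triv_ext triv_twist triv_twist_monoid_morphism.

Lemma pure_balanced (M : lmodType R) (r : R) (x : M) :
  pure pi (pi r) x = pure pi 1 (r *: x).
Proof. by rewrite -[pi r]mul1r; apply/tensor_eqP/tensor_bal. Qed.

Hypothesis pi_epi : ring_epi pi.

(** At [s], the second components of [triv_incl] and [triv_twist] are [0] and [s ⊗ 1 - 1 ⊗ s]. *)
Lemma epi_pure1r (s : S) : s ⊗ 1 = 1 ⊗ s.
Proof.
suff /pi_epi/(_ s)/(congr1 snd)/= /esym/eqP :
    (triv_incl : {rmorphism S -> triv_ext}) \o pi
    =1 (triv_twist : {rmorphism S -> triv_ext}) \o pi.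
  by rewrite subr_eq0 => /eqP.
(* The twist vanishes on [pi r], since a scalar from [R] moves across the tensor sign. *)
move=> r; congr (_, _) => /=; rewrite pure_balanced.
by rewrite -[r *: _]/(pi r * 1) mulr1 subrr.
Qed.

Lemma epi_pure (N : lmodType S) (s : S) (x : restr pi N) :
  pure pi s x = pure pi 1 (s *: (x : N) : restr pi N).
Proof.
have /(congr1 (@self_tensor_eval N x)) := epi_pure1r s.
by rewrite !self_tensor_evalE scale1r.
Qed.

(** For general [pi] the unit is only R-linear; [epi_pure] makes it S-linear, as an isomorphism must
    be for [rk_iso] over [S]. *)
Lemma epi_unit_linear (N : lmodType S) :
  linear (tensor_unit pi (restr pi N) : N -> tensor pi (restr pi N)).
Proof.
move=> a x y; rewrite /tensor_unit pureZ mulr1 (epi_pure a).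
exact: pure_addr.
Qed.

Definition restr_counit (N : lmodType S) : {linear tensor pi (restr pi N) -> N} :=
  tensor_lift (@idfun (restr pi N)).

Definition epi_unit (N : lmodType S) : {linear N -> tensor pi (restr pi N)} :=
  mk_linear (@epi_unit_linear N).

Lemma epi_unitK (N : lmodType S) : cancel (epi_unit N) (restr_counit N).
Proof. by move=> x; rewrite /= tensor_lift_pure scale1r. Qed.

Lemma restr_counitK (N : lmodType S) : cancel (restr_counit N) (epi_unit N).
Proof.
(* Both sides being S-linear, the elements [1 ⊗ x] suffice. *)
apply: (tensor_ext (f := epi_unit N \o restr_counit N) (g := idfun)) => x.
by rewrite /= tensor_lift_pure scale1r.
Qed.

(** The isomorphisms [epi_unit] intertwine [alpha] with [id ⊗ alpha]: both composites send [x] to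
    [1 ⊗ alpha x]. *)
Lemma rk_restr (K : realType) (rk : ext_sylvester K S) (N1 N2 : lmodType S)
    (alpha : {linear N1 -> N2}) :
  rk N1 N2 alpha
  = pullback pi rk (restr pi N1) (restr pi N2) (restr_map pi alpha).
Proof.
apply: (rk_iso (rankP rk) (@epi_unitK N1) (@restr_counitK N1)
  (@epi_unitK N2) (@restr_counitK N2)) => x.
by rewrite /= tensor_mapE.
Qed.

End Bimodule.

Theorem theorem8p1 (K : realType) (R S : pzRingType) (pi : {rmorphism R -> S})
    (pi_epi : ring_epi pi) :
  (forall (rk_S : ext_sylvester K S) (N1 N2 : lmodType S)
     (alpha : {linear N1 -> N2}),
     rk_S N1 N2 alpha
     = pullback pi rk_S (restr pi N1) (restr pi N2) (restr_map pi alpha))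
  /\ injective (@pullback K R S pi).
Proof.
split=> [rk N1 N2 alpha|rk1 rk2 e]; first exact: rk_restr.
(* Each rank over [S] is recovered from its pullback, evaluated on restricted maps. *)
by apply: ext_sylvester_eq => M N f; rewrite !(rk_restr pi_epi) e.
Qed.
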